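(* Let $X$ be an infinite set. If $S$ is a semigroup such that $\mathrm{BL}_X\leq S\leq \mathrm{Inj}_X$ (i.e. $\mathrm{BL}_X$ is a subsemigroup of $S$ and $S$ is a subsemigroup of $\mathrm{Inj}_X$) and $S\setminus \mathrm{BL}_X$ is finite, then $D_r(S)=3$. In particular, $\mathrm{BL}_X$ and $\mathrm{BL}_X^1$ have right diameter $3$.
   Context: Maps are written on the right of their arguments and composed from left to right. $\mathrm{Inj}_X$ is the monoid of all injective maps $X\to X$. $\mathrm{BL}_X=\{\alpha\in \mathrm{Inj}_X : |X\setminus \operatorname{im}\alpha|=|X|\}$ (the Baer-Levi semigroup on $X$), and $\mathrm{BL}_X^1=\mathrm{BL}_X\cup\{1_X\}$, where $1_X$ is the identity map. Right diameter. For a semigroup $S$, $S^1$ is $S$ with an identity adjoined if $S$ has none ($S^1=S$ if $S$ is a monoid). A right congruence on $S$ is an equivalence relation $\rho$ such that $(a,b)\in\rho$ implies $(as,bs)\in\rho$ for all $s\in S$; $\langle U\rangle$ denotes the smallest right congruence containing $U\subseteq S\times S$. The universal relation $S\times S$ viewed as a right congruence is denoted $\omega_S^r$; it is finitely generated if $\omega_S^r=\langle U\rangle$ for some finite $U\subseteq S\times S$. A $U$-sequence of length $n\geq 1$ from $a$ to $b$ is a sequence $a=u_1s_1,\ v_1s_1=u_2s_2,\ \dots,\ v_ns_n=b$ where, for each $i$, $(u_i,v_i)\in U$ or $(v_i,u_i)\in U$, and $s_i\in S^1$; if $a=b$ then $a,b$ are related by a $U$-sequence of length $0$. If $\omega_S^r=\langle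 U\rangle$, let $d_U^r(a,b)$ be the least length of a $U$-sequence from $a$ to $b$ and $D_r(U,S)=\sup\{d_U^r(a,b):a,b\in S\}$. If $\omega_S^r$ is finitely generated, the right diameter of $S$ is $D_r(S)=\min\{D_r(U,S): \omega_S^r=\langle U\rangle,\ U\text{ finite}\}$. Saying $D_r(S)=n$ (or ''$S$ has right diameter $n$'') includes the assertion that $\omega_S^r$ is finitely generated. *)

(* Defs.v *)
From HB Require Import structures.
From mathcomp Require Import all_boot all_order.
From mathcomp Require Import boolp classical_sets functions cardinality.

Set Implicit Arguments.
Unset Strict Implicit.
Unset Printing Implicit Defensive.

Local Open Scope classical_set_scope.
Local Open Scope card_scope.
Local Open Scope group_scope.

Section RightDiameter.
Context (S : semigroupType).

Definition right_congruence (rho : set (S * S)) : Prop :=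
  [/\ forall a, rho (a, a),
      forall a b, rho (a, b) -> rho (b, a),
      forall a b c, rho (a, b) -> rho (b, c) -> rho (a, c) &
      forall a b s, rho (a, b) -> rho (a * s, b * s)].

Definition generates_universal (U : set (S * S)) : Prop :=
  smallest right_congruence U = [set: S * S].

Definition has_identity : Prop :=
  exists e : S, forall x : S, e * x = x /\ x * e = x.

(* S^1 as a subset of option S: None is the adjoined identity, available only
   when S has no identity of its own. *)
Definition S1 : set (option S) := [set s | s = None -> ~ has_identity].

Definition mulS1 (a : S) (s : option S) : S :=
  if s is Some t then a * t else a.

Definition Ustep (U : set (S * S)) (a b : S) : Prop :=
  exists u v s, [/\ U (u, v) \/ U (v, u), S1 s, a = mulS1 u s & b = mulS1 v s].

Inductive Useq (U : set (S * S)) : nat -> S -> S -> Prop :=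
| Useq0 a : Useq U 0 a a
| UseqS n a b c : Ustep U a b -> Useq U n b c -> Useq U n.+1 a c.

(* d_U^r(a, b) = n *)
Definition Udist (U : set (S * S)) (a b : S) (n : nat) : Prop :=
  Useq U n a b /\ forall m, Useq U m a b -> (n <= m)%N.

(* D_r(U, S) = n for a natural number n. When U generates the universal
   relation every pair (a, b) has a distance, and D_r(U, S) is infinite exactly
   when this holds for no n. *)
Definition Udiameter (U : set (S * S)) (n : nat) : Prop :=
  isLub [set d | exists a b, Udist U a b d] n.

(* D_r(S) = n for a natural number n: the minimum over the finite generating
   sets is attained at the value n; generating sets with D_r(U, S) infinite
   satisfy the lower bound trivially. *)
Definition has_right_diameter (n : nat) : Prop :=
  (exists U : set (S * S),
     [/\ finite_set U, generates_universal U & Udiameter U n]) /\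
  (forall U m, finite_set U -> generates_universal U -> Udiameter U m ->
     (n <= m)%N).

End RightDiameter.
Arguments has_right_diameter S n : clear implicits.

(* A subsemigroup S of T is a multiplicatively closed predicate; as a semigroup
   in its own right it is the subtype {x | x \in S}. *)
HB.instance Definition _ (T : semigroupType) (S : mulgClosed T) :=
  SubChoice_isSubSemigroup.Build T (fun x => x \in S) {x : T | x \in S}
    (@gpredM T S).

Record InjMap (X : Type) := MkInjMap {
  InjMap_fun :> X -> X;
  InjMap_inj : injective InjMap_fun }.

Section InjMonoid.
Context (X : Type).

HB.instance Definition _ := gen_eqMixin (InjMap X).
HB.instance Definition _ := gen_choiceMixin (InjMap X).

Lemma InjMap_eq (a b : InjMap X) : a =1 b -> a = b.
Proof.
case: a b => [f fi] [g gi] /= /funext fg; rewrite -fg in gi *.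
by rewrite (Prop_irrelevance fi gi).
Qed.

Definition InjMap_one : InjMap X := MkInjMap (@inj_id X).

(* maps act on the right: a * b is a followed by b *)
Definition InjMap_mul (a b : InjMap X) : InjMap X :=
  MkInjMap (inj_comp (@InjMap_inj _ b) (@InjMap_inj _ a)).

Fact InjMap_mulA : associative InjMap_mul.
Proof. by move=> a b c; apply: InjMap_eq. Qed.
Fact InjMap_mul1 : left_id InjMap_one InjMap_mul.
Proof. by move=> a; apply: InjMap_eq. Qed.
Fact InjMap_1mul : right_id InjMap_one InjMap_mul.
Proof. by move=> a; apply: InjMap_eq. Qed.

HB.instance Definition _ := isMonoid.Build (InjMap X) InjMap_mulA InjMap_mul1 InjMap_1mul.

Definition BL : {pred InjMap X} := fun a => ~` range a #= [set: X].

Definition BL1 : {pred InjMap X} := fun a => (a == 1) || (a \in BL).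

Fact BL_mulg_closed : mulg_closed BL.
Proof.
move=> a b _; rewrite !unfold_in => /card_eqPle[_ Xb].
apply/card_eqPle; split; first exact: subset_card_le.
apply: card_le_trans Xb _; apply: subset_card_le.
by apply: subsetC => _ [x _ <-]; exists (a x).
Qed.
HB.instance Definition _ := isMulClosed.Build (InjMap X) BL BL_mulg_closed.

Fact BL1_mulg_closed : mulg_closed BL1.
Proof.
have BL1E x : (x \in BL1) = (x == 1) || (x \in BL) by [].
move=> a b; rewrite !BL1E => /orP[/eqP->|aBL] /orP[/eqP->|bBL].
- by rewrite mulg1 eqxx.
- by rewrite mul1g bBL orbT.
- by rewrite mulg1 aBL orbT.
- by rewrite BL_mulg_closed ?orbT.
Qed.
HB.instance Definition _ := isMulClosed.Build (InjMap X) BL1 BL1_mulg_closed.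

End InjMonoid.
Arguments BL X : clear implicits.
Arguments BL1 X : clear implicits.

(* Main.v *)
Require Import Defs.
From HB Require Import structures.
From mathcomp Require Import all_boot all_order.
From mathcomp Require Import boolp classical_sets functions cardinality.
From mathcomp Require Import zify.

(** Maps act on the right here. Call a subset of X large when X injects into it;
then BL_X consists of the injections whose image has large complement.

Lower bound. If a = u s and c = v s with s injective, then c is forced on the
points x with x v in im u (there x c = y a, where x v = y u), and sends every
other point outside im a. For a finite U, a path of length at most two from a
to b uses two pairs (u, v) and (q, p), with a = u s, c = v s = p t and b = q t.
Pick a, b in BL_X with im a and im b covering X, and such that a finite set Y,
collecting one coincidence for each pair of pairs in U, satisfies
Y a <= (X \ Y) b and Y b <= (X \ Y) a ([entangled_pair]). If im u meets im v,
then at one chosen point x the map c is a value y a with y in Y; as y a is also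
w b with w not in Y, the point x satisfies x p = w q, a coincidence that puts w
in Y, a contradiction. The same holds if im p meets im q. Otherwise c avoids
both im a and im b, that is, all of X. So no such path exists ([far_pair]).

Upper bound. Let u, v be injections whose images partition X, and take
U = W x W with W = {u, v} together with S \ BL_X. The pair (u, v) links a and c
in one step as soon as their images are disjoint and the union of these images
has large complement ([apart_step]). Any a, b in BL_X are joined by
a - c - d - b, where the images of c and d lie in disjoint large parts of
X \ im a and X \ im b ([apart_path]). An element g outside BL_X is one step
away from both u and v, and one of them is two steps away from the given a in
BL_X ([apart_half]); two elements outside BL_X are one step apart.

Choosing the images needs cardinal arithmetic: X is in bijection with a product
F x nat ([infinite_rows]), and if a union of two sets is large then one of them
is ([large_setU]). Both rest on Zorn's lemma in the form [maximal_pairwise]. *)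

Set Implicit Arguments.
Unset Strict Implicit.
Unset Printing Implicit Defensive.

Local Open Scope classical_set_scope.
Local Open Scope card_scope.
Local Open Scope group_scope.

(** * Cardinal arithmetic of an infinite set *)

(** Pairwise conditions are preserved by unions of chains, so Zorn's lemma
applies; stating it this way serves both for families of disjoint sequences and
for partial matchings. *)
Lemma maximal_pairwise (T : Type) (r : T -> T -> Prop) :
  exists M : set T, (forall x y, M x -> M y -> r x y) /\
    forall x, r x x -> (forall y, M y -> r x y /\ r y x) -> M x.
Proof.
pose P := [set M : set T | forall x y, M x -> M y -> r x y].
have [F FP Ftot|M [PM Mmax]] := @Zorn_bigcup T P.
  move=> x y [A FA Ax] [B FB By].
  have [AB|BA] := Ftot _ _ FA FB.
    by apply: (FP _ FB) => //; apply: AB.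
  by apply: (FP _ FA) => //; apply: BA.
exists M; split=> // x rxx rxM; apply: contrapT => nMx.
apply: (Mmax (M `|` [set x])).
  split=> [z Mz|MxM]; first by left.
  by apply: nMx; apply: MxM; right.
move=> y z [My|->] [Mz|->] //; first exact: PM.
  by have [] := rxM _ My.
by have [] := rxM _ Mz.
Qed.

Lemma card_leTP (U T : Type) (A : set T) : [set: U] #<= A <->
  exists f : U -> T, injective f /\ range f `<=` A.
Proof.
split=> [/card_leP[f]|[f [finj fA]]].
  exists (fun x => val (f (SigSub (mem_set (I : [set: U] x))))); split.
    by move=> x y /val_inj /inj; rewrite !inE => /(_ I I) /(congr1 val).
  by move=> _ [x _ <-]; apply: set_mem; apply: valP.
apply: card_le_trans (subset_card_le fA).
by have := inj_card_eq (in2W finj : {in [set: U] &, injective f});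
  rewrite card_eq_le => /andP[].
Qed.

Lemma countable_infinite_enum (T : Type) (A : set T) :
  countable A -> infinite_set A ->
  exists k : nat -> T, injective k /\ range k = A.
Proof.
move=> cA iA.
have /card_set_bijP[h [_ hinj hsurj]] := eq_card_nat cA iA.
have /choice[k kP] : forall n, exists x, A x /\ h x = n.
  by move=> n; have [x Ax hx] := hsurj n I; exists x.
exists k; split.
  by move=> m n kmn; rewrite -(kP m).2 -(kP n).2 kmn.
apply/seteqP; split=> [_ [n _ <-]|x Ax]; first exact: (kP n).1.
exists (h x) => //; apply: hinj; rewrite ?inE ?(kP _).2 //; exact: (kP _).1.
Qed.

(** A maximal family of injective sequences with pairwise disjoint ranges misses
only finitely many points, and these can be absorbed into one of the sequences.
*)
Lemma infinite_rows (X : Type) : infinite_set [set: X] ->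
  exists (F : Type) (e : F * nat -> X) (d : X -> F * nat),
    cancel e d /\ cancel d e.
Proof.
move=> Xinf.
(* For f = g this says that f is injective, otherwise that the ranges are
   disjoint. *)
pose r (f g : nat -> X) := forall m n, f m = g n -> f = g /\ m = n.
have [M [Mr Mmax]] := maximal_pairwise r.
pose R := [set x | forall f, M f -> ~ range f x].
have Rfin : finite_set R.
  apply: contrapT => /infiniteP/card_leTP[f [finj fR]].
  have Mf : M f.
    apply: Mmax => [m n /finj ->//|g Mg].
    split=> m n fg; exfalso.
      by apply: (fR (f m) _ g Mg); [exists m|exists n].
    by apply: (fR (f n) _ g Mg); [exists n|exists m].
  by apply: (fR (f 0%N) _ f Mf); exists 0%N.
have [f0 Mf0] : exists f0, M f0.
  apply: contrapT => nM; apply: Xinf; apply: sub_finite_set Rfin => x _ f Mf.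
  by case: nM; exists f.
have f0inj : injective f0 by move=> m n /(Mr _ _ Mf0 Mf0)[].
(* The sequence f0 is replaced by an enumeration of A0. *)
pose A0 := R `|` range f0.
have A0c : countable A0.
  have -> : A0 = \bigcup_(b in [set: bool]) (if b then R else range f0).
    apply/seteqP; split=> [x [Rx|fx]|x [[] _ /= ?]]; last 2 first.
    - by left.
    - by right.
    - by exists true.
    - by exists false.
  apply: bigcup_countable => // -[] _; first exact: finite_set_countable.
  by apply: sub_countable (countableP [set: nat]); exact: card_image_le.
have A0inf : infinite_set A0.
  by apply/infiniteP/card_leTP; exists f0; split=> // x ?; right.
have [k [kinj kA0]] := countable_infinite_enum A0c A0inf.
pose row (f : nat -> X) := if `[< f = f0 >] then k else f.
have rowinj (f g : nat -> X) m n :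
    M f -> M g -> row f m = row g n -> f = g /\ m = n.
  have kf f' i j : M f' -> f' <> f0 -> k i = f' j -> False.
    move=> Mf' nf' kE; have : A0 (k i) by rewrite -kA0; exists i.
    case=> [Rk|[l _ lE]]; first by apply: (Rk f' Mf'); exists j.
    by apply: nf'; have [] := Mr _ _ Mf' Mf0 j l; rewrite // -kE lE.
  move=> Mf Mg; rewrite /row; case: asboolP => [->|nf]; case: asboolP => [->|ng].
  - by move/kinj.
  - by move/kf => /(_ Mg ng).
  - by move/esym/kf => /(_ Mf nf).
  - exact: Mr.
pose e (p : {f | M f} * nat) := row (sval p.1) p.2.
have einj : injective e.
  case=> [[f Mf] m] [[g Mg] n] /(rowinj _ _ _ _ Mf Mg)[fg /= ->].
  by congr (_, _); apply: eq_exist.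
have /choice[d dK] : forall x, exists p, e p = x.
  move=> x; have [[f Mf fx]|nx] := pselect (exists2 f, M f & range f x); last first.
    have : A0 x by left => f Mf fx; apply: nx; exists f.
    rewrite -kA0 => -[n _ <-]; exists (exist _ f0 Mf0, n).
    by rewrite /e /row /=; case: asboolP.
  have [ff0|nf] := pselect (f = f0).
    have : A0 x by right; rewrite -ff0.
    rewrite -kA0 => -[n _ <-]; exists (exist _ f0 Mf0, n).
    by rewrite /e /row /=; case: asboolP.
  case: fx => n _ <-; exists (exist _ f Mf, n).
  by rewrite /e /row /=; case: asboolP.
exists {f | M f}, e, d; split=> // p; apply: einj; exact: dK.
Qed.

(** Equivalent to having the cardinality of X; the witness is kept as an element
of the monoid because it is mostly composed with other injections. *)
Definition large (X : Type) (A : set X) := exists f : InjMap X, range f `<=` A.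

Lemma largeP (X : Type) (A : set X) : large A <-> [set: X] #<= A.
Proof.
rewrite card_leTP; split=> [[f fA]|[f [finj fA]]].
  by exists f; split=> //; exact: InjMap_inj.
by exists (MkInjMap finj).
Qed.

Lemma BLP (X : Type) (a : InjMap X) : a \in BL X <-> large (~` range a).
Proof.
rewrite unfold_in /BL largeP; split=> [/card_eqPle[]//|Xa].
by apply/card_eqPle; split=> //; exact: card_leT.
Qed.

Lemma large_sub (X : Type) (A B : set X) : A `<=` B -> large A -> large B.
Proof. by move=> AB [f fA]; exists f; exact: subset_trans AB. Qed.

(** A maximal partial matching between P and Q exhausts P or exhausts Q. *)
Lemma injection_comparable (T : Type) (P Q : set T) :
  (exists h : T -> T, (forall x, P x -> Q (h x)) /\
     forall x y, P x -> P y -> h x = h y -> x = y) \/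
  (exists h : T -> T, (forall x, Q x -> P (h x)) /\
     forall x y, Q x -> Q y -> h x = h y -> x = y).
Proof.
pose r (p q : T * T) := [/\ P p.1, Q p.2 & p.1 = q.1 <-> p.2 = q.2].
have [M [Mr Mmax]] := maximal_pairwise r.
have [Pall|] := pselect (forall x, P x -> exists y, M (x, y)).
  left; have /choice[h hM] : forall x, exists y, P x -> M (x, y).
    move=> x; have [Px|nPx] := pselect (P x); last by exists x.
    by have [y] := Pall x Px; exists y.
  exists h; split=> [x Px|x y Px Py hxy].
    by have [] := Mr _ _ (hM x Px) (hM x Px).
  by have [_ _ [_ /(_ hxy)]] := Mr _ _ (hM x Px) (hM y Py).
move=> /existsNP[x /not_implyP[Px nMx]]; right.
have Qall y : Q y -> exists x, M (x, y).
  move=> Qy; apply: contrapT => nMy; apply/nMx; exists y.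
  apply: Mmax => [|[x' y'] Mxy]; first by split.
  have [/= Px' Qy' _] := Mr _ _ Mxy Mxy.
  have nx : x <> x' by move=> xx'; apply: nMx; exists y'; rewrite xx'.
  have ny : y <> y' by move=> yy'; apply: nMy; exists x'; rewrite yy'.
  have iffF (C D : Prop) : ~ C -> ~ D -> (C <-> D) by split.
  by split; split=> //; apply: iffF => // /esym.
have /choice[h hM] : forall y, exists x, Q y -> M (x, y).
  move=> y; have [Qy|nQy] := pselect (Q y); last by exists y.
  by have [x' ?] := Qall y Qy; exists x'.
exists h; split=> [y Qy|y z Qy Qz hyz].
  by have [] := Mr _ _ (hM y Qy) (hM y Qy).
by have [_ _ [/(_ hyz)]] := Mr _ _ (hM y Qy) (hM z Qz).
Qed.

(** The rows indexed by P each contain a copy of nat inside A, and h lets every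
other row share one of those copies, which has room for two rows when split into
even and odd positions. *)
Lemma large_rows (X F : Type) (e : F * nat -> X) (d : X -> F * nat)
    (A : set X) (P : set F) (h : F -> F) :
  cancel e d -> cancel d e ->
  (forall i, P i -> infinite_set [set n | A (e (i, n))]) ->
  (forall i, ~ P i -> P (h i)) ->
  (forall i j, ~ P i -> ~ P j -> h i = h j -> i = j) ->
  large A.
Proof.
move=> ed de Pinf hP hinj.
have /choice[b bP] : forall i, exists b : nat -> nat,
    P i -> injective b /\ range b `<=` [set n | A (e (i, n))].
  move=> i; have [Pi|nPi] := pselect (P i); last by exists id.
  by have /infiniteP/card_leTP[b ?] := Pinf i Pi; exists b.
pose f x := let: (i, n) := d x in
  if `[< P i >] then e (i, b i n.*2) else e (h i, b (h i) n.*2.+1).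
apply/largeP/card_leTP; exists f; split=> [x y|_ [x _ <-]]; last first.
  rewrite /f; case: (d x) => i n; case: asboolP => Pi.
    by apply: (bP i Pi).2; exists n.*2.
  by apply: (bP _ (hP i Pi)).2; exists n.*2.+1.
rewrite /f => fxy; apply: (can_inj de); move: fxy.
case: (d x) => i m; case: (d y) => j n.
case: asboolP => Pi; case: asboolP => Pj /(can_inj ed)[].
- by move=> <- /(bP i Pi).1/double_inj ->.
- by move=> ij; rewrite -ij in Pj *; move=> /(bP i Pi).1 mn; exfalso; lia.
- by move=> ij; rewrite -ij => /(bP _ (hP i Pi)).1 mn; exfalso; lia.
- move=> /(hinj _ _ Pi Pj) <- /(bP _ (hP i Pi)).1 mn.
  by congr (_, _); lia.
Qed.

(** Every row of F x nat meets A or B infinitely often, which splits F in two;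
the row index set that receives an injection from the other carries the whole
of X. *)
Lemma large_setU (X : Type) (A B : set X) : infinite_set [set: X] ->
  large (A `|` B) -> large A \/ large B.
Proof.
move=> Xinf [f fAB].
have [F [e [d [ed de]]]] := infinite_rows Xinf.
pose A' := f @^-1` A; pose B' := f @^-1` B.
have from C : large (f @^-1` C) -> large C.
  by case=> g gC; exists (g * f) => _ [x _ <-]; apply: gC; exists x.
pose P := [set i | infinite_set [set n | A' (e (i, n))]].
have nP i : ~ P i -> infinite_set [set n | B' (e (i, n))].
  move=> /contrapT Afin Bfin; apply: infinite_nat.
  apply: sub_finite_set (_ : finite_set (_ `|` _)); last first.
    by rewrite finite_setU; split; [exact: Afin|exact: Bfin].
  by move=> n _; apply: fAB; exists (e (i, n)).
have [[h [hP hinj]]|[h [hP hinj]]] := injection_comparable (~` P) P.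
  by left; apply: from; apply: (large_rows ed de (P := P) (h := h)).
right; apply: from; apply: (large_rows ed de (P := ~` P) (h := h)) => //.
  by move=> i /contrapT /hP.
by move=> i j /contrapT Pi /contrapT Pj; exact: hinj.
Qed.

(** * Special injections *)

Definition row_map (X F : Type) (e : F * nat -> X) (d : X -> F * nat)
  (phi : nat -> nat) (x : X) : X := e ((d x).1, phi (d x).2).

Lemma row_map_inj (X F : Type) (e : F * nat -> X) (d : X -> F * nat)
    (phi : nat -> nat) :
  cancel e d -> cancel d e -> injective phi -> injective (row_map e d phi).
Proof.
move=> ed de phiI x y /(can_inj ed)[xy1 /phiI xy2]; apply: (can_inj de).
by rewrite [LHS]surjective_pairing [RHS]surjective_pairing xy1 xy2.
Qed.

Lemma disjoint_BL (X : Type) (a c : InjMap X) :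
  (forall x y, a x <> c y) -> a \in BL X.
Proof.
by move=> ac; apply/BLP; exists c => _ [y _ <-] [x _]; exact: ac.
Qed.

Lemma halves (X : Type) : infinite_set [set: X] ->
  exists u v : InjMap X, (forall x y, u x <> v y) /\
    forall z, range u z \/ range v z.
Proof.
move=> /infinite_rows[F [e [d [ed de]]]].
have uI : injective (fun n : nat => n.*2) by exact: double_inj.
have vI : injective (fun n : nat => n.*2.+1) by move=> m n [] /double_inj.
exists (MkInjMap (row_map_inj ed de uI)), (MkInjMap (row_map_inj ed de vI)).
split=> [x y /= /(can_inj ed)[_]|z]; first lia.
rewrite -(de z); case: (d z) => i n.
rewrite -(odd_double_half n); case: (odd n); [right|left];
  by exists (e (i, n./2)); rewrite //= /row_map ed.
Qed.

(** In F x nat let both maps preserve rows, with Y inside the first N columns.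
The images share the first 2N columns, where the first map is the identity and
the second swaps the two blocks of N columns; beyond them, one image takes the
even columns and the other the odd ones. *)
Lemma entangled_pair (X : Type) (Y : set X) :
  infinite_set [set: X] -> finite_set Y ->
  exists a b : InjMap X, [/\ a \in BL X, b \in BL X,
    forall z, range a z \/ range b z,
    forall y, Y y -> exists2 w, ~ Y w & a y = b w &
    forall y, Y y -> exists2 w, ~ Y w & b y = a w].
Proof.
move=> /infinite_rows[F [e [d [ed de]]]] Yfin.
have [N NY] : exists N, forall y, Y y -> ((d y).2 < N)%N.
  have /finite_seqP[s sE] := finite_image (fun y => (d y).2) Yfin.
  exists (\max_(n <- s) n).+1 => y Yy; rewrite ltnS.
  have ys : (d y).2 \in s.
    by have : [set` s] (d y).2; [rewrite -sE; exists y|].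
  by rewrite (big_rem _ ys) leq_maxl.
pose phi n := if (n < N.*2)%N then n else (N.*2 + (n - N.*2).*2)%N.
pose psi n := if (n < N)%N then (n + N)%N else
  if (n < N.*2)%N then (n - N)%N else (N.*2 + (n - N.*2).*2.+1)%N.
have phiI : injective phi by rewrite /phi => m n; do 2!case: ltnP => ?; lia.
have psiI : injective psi.
  by rewrite /psi => m n; do !case: ltnP => ?; lia.
exists (MkInjMap (row_map_inj ed de phiI)), (MkInjMap (row_map_inj ed de psiI)).
(* The columns missed by one of the maps, which make the complement large. *)
have offI k : injective (fun n => (N.*2 + (n.*2 + k))%N) by move=> m n; lia.
split.
- apply/(@disjoint_BL _ _ (MkInjMap (row_map_inj ed de (offI 1%N)))) => x y.
  by move=> /(can_inj ed)[_]; rewrite /phi; do !case: ltnP => ?; lia.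
- apply/(@disjoint_BL _ _ (MkInjMap (row_map_inj ed de (offI 0%N)))) => x y.
  by move=> /(can_inj ed)[_]; rewrite /psi; do !case: ltnP => ?; lia.
- have hit chi (chiI : injective chi) i n m : chi n = m ->
    range (MkInjMap (row_map_inj ed de chiI)) (e (i, m)).
    by move=> <-; exists (e (i, n)) => //=; rewrite /row_map ed.
  move=> z; rewrite -(de z); case: (d z) => i n.
  have [nN|nN] := ltnP n (N.*2).
    by left; apply: (hit _ _ _ n); rewrite /phi nN.
  case: (boolP (odd (n - N.*2))) => nodd.
    right; apply: (hit _ _ _ (N.*2 + (n - N.*2)./2)%N);
    rewrite /psi; do !case: ltnP => ?; lia.
  left; apply: (hit _ _ _ (N.*2 + (n - N.*2)./2)%N);
  rewrite /phi; do !case: ltnP => ?; lia.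
- move=> y /NY yN; exists (e ((d y).1, ((d y).2 + N)%N)).
    by move=> /NY; rewrite ed /=; lia.
  by rewrite /= /row_map ed /=; congr (e (_, _));
  rewrite /phi /psi; do !case: ltnP => ?; lia.
- move=> y /NY yN; exists (e ((d y).1, ((d y).2 + N)%N)).
    by move=> /NY; rewrite ed /=; lia.
  by rewrite /= /row_map ed /=; congr (e (_, _));
  rewrite /phi /psi; do !case: ltnP => ?; lia.
Qed.

(** * Two steps do not suffice *)

(** Reading the second step backwards makes the two steps play the same role:
a and b both reach the middle element by a pair of V. Whether a coincidence of
the two components of such a pair exists depends on the pair alone, hence
finitely many coincidences are enough to defeat all candidates. *)
Lemma far_pair (X : Type) (V : set (InjMap X * InjMap X)) :
  infinite_set [set: X] -> finite_set V ->
  exists a b : InjMap X, [/\ a \in BL X, b \in BL X &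
    forall p q s t, V p -> V q -> a = p.1 * s -> b = q.1 * t ->
      p.2 * s <> q.2 * t].
Proof.
move=> Xinf Vfin.
(* r p is a point where the images of the components of p meet, when they do;
   g (p, q) is the point through which q would determine the value there. *)
have [x0 _] : [set: X] !=set0 by apply: infinite_setN0.
have /choice[r rP] : forall p : InjMap X * InjMap X, exists x,
    (exists x, range p.1 (p.2 x)) -> range p.1 (p.2 x).
  move=> p; have [[x px]|np] := pselect (exists x, range p.1 (p.2 x)).
    by exists x.
  by exists x0.
have /choice[g gP] :
    forall pq : (InjMap X * InjMap X) * (InjMap X * InjMap X), exists y,
    range pq.2.1 (pq.2.2 (r pq.1)) -> pq.2.1 y = pq.2.2 (r pq.1).
  move=> [p q]; have [[y _ qy]|nq] := pselect (range q.1 (q.2 (r p))).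
    by exists y.
  by exists x0.
pose Y := g @` (V `*` V).
have Yfin : finite_set Y by apply: finite_image; exact: finite_setX.
have YP p q y : V p -> V q -> q.1 y = q.2 (r p) -> Y y.
  move=> Vp Vq qy; exists (p, q) => //; apply: (@InjMap_inj _ q.1).
  by rewrite qy; apply: (gP (p, q)); exists y.
have [a [b [aBL bBL ab aY bY]]] := entangled_pair Xinf Yfin.
exists a, b; split=> // p q s t Vp Vq aE bE cE.
(* A coincidence of p' makes the middle map take at r p' a value of a' on Y;
   this is also the value of b' at some w outside Y, although w is the
   coincidence point of q' for r p'. *)
have meet (a' b' s' t' : InjMap X) p' q' :
    V p' -> V q' -> a' = p'.1 * s' -> b' = q'.1 * t' ->
    p'.2 * s' = q'.2 * t' ->
    (forall y, Y y -> exists2 w, ~ Y w & a' y = b' w) ->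
    forall x y, p'.1 y <> p'.2 x.
  move=> Vp' Vq' a'E b'E c'E a'Y x y pxy.
  have [y' _ py'] : range p'.1 (p'.2 (r p')) by apply: rP; exists x, y.
  have [w nYw] := a'Y y' (YP _ _ _ Vp' Vp' py').
  rewrite a'E b'E /= py' => /esym wE; apply: nYw; apply: (YP p' q') => //.
  apply: (@InjMap_inj _ t'); rewrite wE.
  exact: (congr1 (fun f : InjMap X => f (r p')) c'E).
(* Otherwise the middle map avoids both images, which cover X. *)
have cp x : (p.2 * s) x = s (p.2 x) by [].
have [[y _ ay]|[y _ ay]] := ab ((p.2 * s) x0).
  apply: (meet _ _ _ _ _ _ Vp Vq aE bE cE aY x0 y).
  by apply: (@InjMap_inj _ s); rewrite -cp -ay aE.
apply: (meet _ _ _ _ _ _ Vq Vp bE aE (esym cE) bY x0 y).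
apply: (@InjMap_inj _ t); move: ay; rewrite cE bE; exact.
Qed.

(** * Steps between maps with disjoint images *)

Definition apart (X : Type) (a c : InjMap X) :=
  (forall x y, a x <> c y) /\ large (~` (range a `|` range c)).

(** Since the images of u and v partition X, the two equations define s
completely, and its image is the union of the images of a and c. *)
Lemma apart_step (X : Type) (u v a c : InjMap X) :
  (forall x y, u x <> v y) -> (forall z, range u z \/ range v z) ->
  apart a c -> exists s, [/\ s \in BL X, a = u * s & c = v * s].
Proof.
move=> uv uvT [ac acL].
have /choice[f fP] : forall z, exists w,
    (forall x, u x = z -> w = a x) /\ (forall x, v x = z -> w = c x).
  move=> z; have [[x _ <-]|[x _ <-]] := uvT z.
    exists (a x); split=> [y /(@InjMap_inj _ u) ->//|y /esym/uv//].
  exists (c x); split=> [y /uv//|y /(@InjMap_inj _ v) ->//].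
have fu x : f (u x) = a x by exact: (fP (u x)).1.
have fv x : f (v x) = c x by exact: (fP (v x)).2.
have fI : injective f.
  move=> y z; have [[y' _ <-]|[y' _ <-]] := uvT y;
    have [[z' _ <-]|[z' _ <-]] := uvT z; rewrite ?fu ?fv.
  - by move=> /(@InjMap_inj _ a) ->.
  - by move=> /ac.
  - by move=> /esym/ac.
  - by move=> /(@InjMap_inj _ c) ->.
exists (MkInjMap fI); split.
- apply/BLP; apply: large_sub acL; apply: subsetC => _ [z _ <-] /=.
  have [[x _ <-]|[x _ <-]] := uvT z; rewrite ?fu ?fv; [left|right];
  by exists x.
- by apply: InjMap_eq => x; rewrite /= fu.
- by apply: InjMap_eq => x; rewrite /= fv.
Qed.

Lemma large_split (X : Type) (A : set X) : infinite_set [set: X] -> large A ->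
  exists f g : InjMap X,
    [/\ range f `<=` A, range g `<=` A & forall x y, f x <> g y].
Proof.
move=> Xinf [f fA]; have [u [v [uv _]]] := halves Xinf.
exists (u * f), (v * f); split.
- by move=> _ [x _ <-]; apply: fA; exists (u x).
- by move=> _ [x _ <-]; apply: fA; exists (v x).
- by move=> x y /(@InjMap_inj _ f); exact: uv.
Qed.

Lemma apart_sym (X : Type) (a c : InjMap X) : apart a c -> apart c a.
Proof. by move=> [ac acL]; split=> [x y /esym/ac//|]; rewrite setUC. Qed.

(** The image of w is what makes the complement of the union large. *)
Lemma apart_witness (X : Type) (a c w : InjMap X) :
  (forall x y, a x <> c y) -> (forall x y, a x <> w y) ->
  (forall x y, c x <> w y) -> apart a c.
Proof.
move=> ac aw cw; split=> //; exists w => _ [y _ <-] [[x _]|[x _]].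
  exact: aw.
exact: cw.
Qed.

(** Halve A. Either B is large outside the first half, or B is large inside it
and hence outside the second half. *)
Lemma large_disjoint (X : Type) (A B : set X) : infinite_set [set: X] ->
  large A -> large B ->
  exists f g : InjMap X,
    [/\ range f `<=` A, range g `<=` B & forall x y, f x <> g y].
Proof.
move=> Xinf AL [g gB].
have [f1 [f2 [f1A f2A f12]]] := large_split Xinf AL.
have : large ((B `&` range f1) `|` (B `\` range f1)).
  exists g => z gz; have [zf|zf] := pselect (range f1 z); [left|right];
  by split=> //; apply: gB.
move=> /(large_setU Xinf)[[h hB]|[h hB]].
  exists f2, h; split=> // [z /hB[]//|x y f2h].
  have [_ [x' _ f1h]] : (B `&` range f1) (h y) by apply: hB; exists y.
  by apply: (f12 x' x); rewrite f1h f2h.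
exists f1, h; split=> // [z /hB[]//|x y f1h].
have [_] : (B `\` range f1) (h y) by apply: hB; exists y.
by apply; exists x.
Qed.

Lemma range_setC (X : Type) (a f : InjMap X) :
  range f `<=` ~` range a -> forall x y, a x <> f y.
Proof. by move=> fa x y axfy; apply: (fa (f y)); [exists y|exists x]. Qed.

(** The images of c and d are halves of the disjoint ranges of f and g, which
lie outside the images of a and b; the unused halves witness the large complements. *)
Lemma apart_path (X : Type) (a b : InjMap X) : infinite_set [set: X] ->
  a \in BL X -> b \in BL X ->
  exists c d, [/\ c \in BL X, d \in BL X & [/\ apart a c, apart c d & apart d b]].
Proof.
move=> Xinf /BLP aL /BLP bL.
have [f [g [/range_setC fa /range_setC gb fg]]] := large_disjoint Xinf aL bL.
have [u [v [uv _]]] := halves Xinf.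
have half (h : InjMap X) x y : (u * h) x <> (v * h) y.
  by move=> /(@InjMap_inj _ h); exact: uv.
exists (u * f), (u * g); split; last split.
- exact: disjoint_BL (half f).
- exact: disjoint_BL (half g).
- by apply: (@apart_witness _ _ _ (v * f)) => // x y; exact: fa.
- apply: (@apart_witness _ _ _ (v * f)) => // x y; first exact: fg.
  by move=> /esym; exact: fg.
- apply: (@apart_witness _ _ _ (v * g)) => // x y; last exact: gb.
  by move=> /esym; exact: gb.
Qed.

(** The complement of im a is covered by its intersections with the complements
of im u and im v, so one intersection is large and has room for the image of
c. *)
Lemma apart_half (X : Type) (u v a : InjMap X) : infinite_set [set: X] ->
  (forall x y, u x <> v y) -> a \in BL X ->
  exists w c, [/\ w = u \/ w = v, c \in BL X, apart a c & apart c w].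
Proof.
move=> Xinf uv /BLP[f /range_setC fa].
pose P (w : InjMap X) := large (~` (range a `|` range w)).
have [w [wuv wL]] : exists w, (w = u \/ w = v) /\ P w.
  suff [uL|vL] : P u \/ P v.
    by exists u; split; [left|].
    by exists v; split; [right|].
  apply: (large_setU Xinf); exists f => _ [y _ <-].
  have na : ~ range a (f y) by move=> [x _]; exact: fa.
  have [[x _ ux]|nu] := pselect (range u (f y)).
    right=> -[//|[z _ vz]]; apply: (uv x z); by rewrite ux vz.
  by left=> -[].
have [c [g [cP gP cg]]] := large_split Xinf wL.
have aw' (h : InjMap X) : range h `<=` ~` (range a `|` range w) ->
    (forall x y, a x <> h y) /\ (forall x y, w x <> h y).
  move=> hP; split; apply: range_setC => z /hP nz rz; apply: nz;
  by [left|right].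
have [ac wc] := aw' c cP; have [ag wg] := aw' g gP.
exists w, c; split=> //; first exact: disjoint_BL cg.
  exact: (@apart_witness _ _ _ g).
by apply: (@apart_witness _ _ _ g) => // x y /esym; exact: wc.
Qed.

(** * Right diameter and U-sequences *)

Section Sequences.
Context (S : semigroupType).
Implicit Types (U : set (S * S)) (a b c : S).

Lemma Ustep_gen U a b : U (a, b) -> Ustep U a b.
Proof.
move=> Uab; have [[e eP]|ne] := pselect (has_identity S).
  by exists a, b, (Some e); split; [left| |rewrite /= (eP a).2|rewrite /= (eP b).2].
by exists a, b, None; split; [left| | |].
Qed.

Lemma Ustep_sym U a b : Ustep U a b -> Ustep U b a.
Proof.
move=> [u [v [s [uv s1 -> ->]]]]; exists v, u, s; split=> //.
by case: uv; [right|left].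
Qed.

Lemma Ustep_mul U a b t : Ustep U a b -> Ustep U (a * t) (b * t).
Proof.
move=> [u [v [s [uv _ -> ->]]]].
exists u, v, (Some (if s is Some s' then s' * t else t)); split=> //;
by case: s => [s|] //=; rewrite mulgA.
Qed.

Lemma Useq_cat U m n a b c : Useq U m a b -> Useq U n b c -> Useq U (m + n) a c.
Proof. by elim=> // m' a' b' c' ab _ IH /IH; apply: UseqS. Qed.

Lemma Useq1 U a b : Ustep U a b -> Useq U 1 a b.
Proof. by move=> ab; apply: UseqS ab (Useq0 _ _). Qed.

Lemma Useq_le2 U n a c : Useq U n a c -> (n <= 2)%N ->
  exists b, (a = b \/ Ustep U a b) /\ (b = c \/ Ustep U b c).
Proof.
case=> [a' _|k a' b c' ab bc]; first by exists a'; split; left.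
move=> k2; exists b; split; first by right.
move: bc k2; case=> [b' _|l b' d e bd de]; first by left.
by case: de bd => [f bf _|//]; right.
Qed.

Lemma Useq_sym U n a b : Useq U n a b -> Useq U n b a.
Proof.
elim=> [a'|n' a' b' c' /Ustep_sym ab _ cb]; first exact: Useq0.
by rewrite -addn1; apply: Useq_cat cb _; exact: Useq1.
Qed.

(** The relation of being joined by a U-sequence is the right congruence
generated by U. *)
Lemma generates_universalP U :
  generates_universal U <-> forall a b, exists n, Useq U n a b.
Proof.
split=> [Ugen a b|Useqs].
  suff sub : smallest (@right_congruence S) U `<=`
      [set p | exists n, Useq U n p.1 p.2].
    by apply: (sub (a, b)); rewrite Ugen.
  apply: smallest_sub => [|[c d] Ucd]; last first.
    by exists 1%N; apply/Useq1/Ustep_gen.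
  split=> /= [c|c d [n cd]|c d e [m cd] [n de]|c d s [n cd]].
  - by exists 0%N; exact: Useq0.
  - by exists n; exact: Useq_sym.
  - by exists (m + n)%N; exact: Useq_cat de.
  - exists n; elim: cd => [c'|n' c' d' e' cd' _ IH]; first exact: Useq0.
    by apply: UseqS IH; exact: Ustep_mul.
apply/seteqP; split=> // -[a b] _ M [[Mr Ms Mt Mm] UM].
have Mstep c d : Ustep U c d -> M (c, d).
  move=> [u [v [s [uv _ -> ->]]]].
  have Muv : M (u, v) by case: uv => /UM // /Ms.
  by case: s => [s|] //=; exact: Mm.
have [n ab] := Useqs a b; elim: ab => [c|n' c d e /Mstep cd _ de] //.
exact: Mt de.
Qed.

Lemma Udist_exists U n a b :
  Useq U n a b -> exists2 m, Udist U a b m & (m <= n)%N.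
Proof.
move=> ab; have ex : exists m, `[< Useq U m a b >] by exists n; apply/asboolP.
case: (ex_minnP ex) => m /asboolP mab mmin; exists m; last exact/mmin/asboolP.
by split=> // k kab; apply/mmin/asboolP.
Qed.

(** A pair that needs n steps turns the upper bound into an exact supremum, and
bounds from below the diameter of every other finite generating set. *)
Lemma right_diameterP n :
  (exists U, finite_set U /\
     forall a b, exists2 m, Useq U m a b & (m <= n)%N) ->
  (forall U, finite_set U -> exists a b, forall m, Useq U m a b -> (n <= m)%N) ->
  has_right_diameter S n.
Proof.
move=> [U [Ufin Un]] far; split.
  exists U; split=> //.
    by apply/generates_universalP => a b; have [m ab _] := Un a b; exists m.
  split=> [k [a [b [_ abmin]]]|k kub].
    have [m ab mn] := Un a b; exact: leq_trans (abmin m ab) mn.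
  have [a [b abn]] := far U Ufin; have [m ab _] := Un a b.
  have [m' abm' _] := Udist_exists ab.
  by apply: leq_trans (abn _ abm'.1) _; apply: kub; exists a, b.
move=> V m Vfin /generates_universalP Vgen [mub _].
have [a [b abn]] := far V Vfin; have [k ab] := Vgen a b.
have [k' abk' _] := Udist_exists ab.
apply: leq_trans (abn _ abk'.1) _; apply: mub; by exists a, b.
Qed.

End Sequences.

(** * The right diameter of S *)

(** A step multiplies both components of a pair of U, in either order, by an
injection; adding the pair (1, 1) treats paths of length less than two as paths
of length two. *)
Lemma far_pair_subsemigroup (X : Type) (S : mulgClosed (InjMap X))
    (U : set ({a : InjMap X | a \in S} * {a : InjMap X | a \in S})) :
  infinite_set [set: X] -> {subset BL X <= S} -> finite_set U ->
  exists a b, forall m, Useq U m a b -> (3 <= m)%N.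
Proof.
move=> Xinf BLS Ufin.
pose V : set (InjMap X * InjMap X) := [set (1, 1)] `|`
  ((fun p => (val p.1, val p.2)) @` U `|` (fun p => (val p.2, val p.1)) @` U).
have Vfin : finite_set V.
  rewrite !finite_setU; split; first exact: finite_set1.
  by split; exact: finite_image.
have Vsym p : V p -> V (p.2, p.1).
  by move=> [->|[[q Uq <-]|[q Uq <-]]]; [left|right; right|right; left]; 
    rewrite //=; exists q.
have [a [b [aBL bBL far]]] := far_pair Xinf Vfin.
pose lift x (xBL : x \in BL X) : {a : InjMap X | a \in S} := exist _ x (BLS x xBL).
exists (lift a aBL), (lift b bBL).
have hop x y : x = y \/ Ustep U x y ->
    exists p s, [/\ V p, val x = p.1 * s & val y = p.2 * s].
  move=> [<-|[u [v [s [uv _ -> ->]]]]].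
    by exists (1, 1), (val x); rewrite /= !mul1g; split=> //; left.
  have Vuv : V (val u, val v).
    by case: uv => Uuv; right; [left; exists (u, v)|right; exists (v, u)].
  case: s => [s|] /=; first by exists (val u, val v), (val s).
  by exists (val u, val v), 1; rewrite /= !mulg1.
move=> m ab; rewrite leqNgt ltnS; apply/negP => /(Useq_le2 ab).
move=> [c [/hop[p [s [Vp aE cE]]] /hop[q [t [Vq cE' bE]]]]].
by apply: (far p (q.2, q.1) s t Vp (Vsym _ Vq) aE bE); rewrite -cE -cE'.
Qed.

(** Taking all pairs from W makes the finitely many elements outside BL_X
adjacent to each other and to both halves u and v. *)
Lemma short_sequences (X : Type) (S : mulgClosed (InjMap X)) :
  infinite_set [set: X] -> {subset BL X <= S} ->
  finite_set [set a : InjMap X | a \in S /\ a \notin BL X] ->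
  exists U : set ({a : InjMap X | a \in S} * {a : InjMap X | a \in S}),
    finite_set U /\ forall a b, exists2 m, Useq U m a b & (m <= 3)%N.
Proof.
move=> Xinf BLS Sfin.
have [u [v [uv uvT]]] := halves Xinf.
pose W : set {a : InjMap X | a \in S} := val @^-1` ([set u; v] `|`
  [set a : InjMap X | a \in S /\ a \notin BL X]).
have Wfin : finite_set W.
  apply: finite_preimage; first by move=> x y _ _; exact: val_inj.
  by rewrite finite_setU; split=> //; exact: finite_set2.
pose U := W `*` W; exists U; split; first exact: finite_setX.
have uBL : u \in BL X by exact: disjoint_BL uv.
have vBL : v \in BL X.
  by apply: (@disjoint_BL _ v u) => x y /esym; exact: uv.
pose lift x (xBL : x \in BL X) : {a : InjMap X | a \in S} :=
  exist _ x (BLS x xBL).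
have Wu : W (lift u uBL) by left; left.
have Wv : W (lift v vBL) by left; right.
have stepU x y : apart (val x) (val y) -> Ustep U x y.
  move=> /(apart_step uv uvT)[s [sBL xE yE]].
  exists (lift u uBL), (lift v vBL), (Some (lift s sBL)).
  by split=> //; [left|apply: val_inj|apply: val_inj].
have outW x : val x \notin BL X -> W x.
  by move=> xBL; right; split=> //; exact: valP.
have outin x y : W x -> val y \in BL X -> Useq U 3 x y.
  move=> Wx yBL; have [w [c [wE cBL yc cw]]] := apart_half Xinf uv yBL.
  have [w' Ww' w'E] : exists2 w', W w' & val w' = w.
    by case: wE => ->; [exists (lift u uBL)|exists (lift v vBL)].
  apply: (UseqS (b := w')); first exact: Ustep_gen.
  apply: (UseqS (b := lift c cBL)).
    by apply: stepU; rewrite w'E; exact: apart_sym.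
  by apply/Useq1/stepU/apart_sym.
move=> x y; case: (boolP (val x \in BL X)) => [xBL|/outW Wx];
  case: (boolP (val y \in BL X)) => [yBL|/outW Wy].
- exists 3%N => //; have [c [d [cBL dBL [xc cd dy]]]] := apart_path Xinf xBL yBL.
  apply: (UseqS (b := lift c cBL)); first exact: stepU.
  apply: (UseqS (b := lift d dBL)); first exact: stepU.
  exact/Useq1/stepU.
- by exists 3%N => //; apply/Useq_sym/outin.
- by exists 3%N => //; exact: outin.
- by exists 1%N => //; exact/Useq1/Ustep_gen.
Qed.

Theorem theorem3p14 (X : Type) (X_infinite : infinite_set [set: X]) :
  (forall S : mulgClosed (InjMap X),
     {subset BL X <= S} ->
     finite_set [set a : InjMap X | a \in S /\ a \notin BL X] ->
     has_right_diameter {a : InjMap X | a \in S} 3) /\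
  has_right_diameter {a : InjMap X | a \in BL X} 3 /\
  has_right_diameter {a : InjMap X | a \in BL1 X} 3.
Proof.
have main (S : mulgClosed (InjMap X)) : {subset BL X <= S} ->
    finite_set [set a : InjMap X | a \in S /\ a \notin BL X] ->
    has_right_diameter {a : InjMap X | a \in S} 3.
  move=> BLS Sfin; apply: right_diameterP; first exact: short_sequences.
  by move=> U; exact: far_pair_subsemigroup.
split=> //; split; apply: main => //.
- by apply: sub_finite_set (finite_set0 _) => a [->].
- by move=> a aBL; rewrite unfold_in /= aBL orbT.
- apply: sub_finite_set (finite_set1 (1 : InjMap X)) => a [aBL1 naBL].
  by move: aBL1; rewrite unfold_in /BL1 (negbTE naBL) orbF => /eqP.
Qed.
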